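(* Let $p\in[1,\infty]$. For every neighbourhood $U$ of the identity $\infty$ in the compact hypergroup $H_{1/2}$ there is a constant $C_U$, independent of $p$, such that $$\|f\|_p\le C_U\|f\mathbf 1_U\|_p$$ for all (locally integrable) functions $f$ of positive type on $H_{1/2}$. (Both sides are allowed to be $+\infty$.)
   Context: $H_{1/2}=\mathbb Z_+\cup\{\infty\}$ is the one-point compactification of $\mathbb Z_+=\{0,1,2,\dots\}$. It is a compact commutative hypergroup with identity $\infty$, identity involution, and convolution of unit point masses $$\varepsilon_n*\varepsilon_n=\sum_{k=1}^\infty 2^{-k}\varepsilon_{n+k}\ (n\in\mathbb Z_+),\qquad \varepsilon_\infty*\varepsilon_\infty=\varepsilon_\infty,\qquad \varepsilon_m*\varepsilon_n=\varepsilon_{\min\{m,n\}}\ (m\ne n).$$ Its Haar measure is $\omega(\{n\})=2^{-(n+1)}$ for $n\in\mathbb Z_+$, $\omega(\{\infty\})=0$; $L^p$ norms are with respect to $\omega$. Write $f(m*n)=\int f\,d(\varepsilon_m*\varepsilon_n)$ and $(f*g)(m)=\int f(m*n)g(n)\,d\omega(n)$. A locally integrable (equivalently, as $H_{1/2}$ is compact, integrable) function $f:H_{1/2}\to\mathbb C$ is of positive type if $\int f\cdot(g*\overline g)\,d\omega\ge0$ for every $g\in C(H_{1/2})$. *)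

(* Defs.v *)
From HB Require Import structures.
From mathcomp Require Import all_boot all_order all_algebra.
From mathcomp Require Import complex.
From mathcomp Require Import all_classical all_reals all_analysis.

Set Implicit Arguments.
Unset Strict Implicit.
Unset Printing Implicit Defensive.
Import Order.TTheory GRing.Theory Num.Theory.
Import numFieldNormedType.Exports.

Local Open Scope complex_scope.
Local Open Scope classical_set_scope.
Local Open Scope ring_scope.

(* [Some n] is the integer [n] and [None] is the point at infinity. *)
Definition Hhalf : Type := one_point_compactification nat.

HB.instance Definition _ := Topological.on Hhalf.
HB.instance Definition _ := Pointed.on Hhalf.

(* Measurable sets are the Borel sets of the compactification topology. *)
HB.instance Definition _ := @isMeasurable.Build
  (sigma_display (@open Hhalf)) Hhalf <<s @open Hhalf >>
  (@sigma_algebra0 _ setT _)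
  (@sigma_algebraC _ _)
  (@sigma_algebra_bigcup _ setT _).

Definition Hhalf_id : Hhalf := None.

Section Hypergroup.
Context {R : realType}.
Local Notation C := (R[i]).
Local Notation measureH := {measure set Hhalf -> \bar R}.

Definition point_mass (x : Hhalf) : measureH := dirac x.

(* sum_(k >= 1) 2^-k eps_(n+k), reindexed by [k = l.+1]. *)
Definition diag_conv (n : nat) : measureH :=
  mseries (fun l => mscale ((2^-1 : R) ^+ l.+1)%:nng
                           (point_mass (Some (n + l.+1)%N))) 0.

(* The convolution of the unit point masses at [x] and [y]. The point at
   infinity is the largest element, hence the identity. *)
Definition Hhalf_conv (x y : Hhalf) : measureH :=
  match x, y with
  | Some m, Some n =>
      if m == n then diag_conv n else point_mass (Some (minn m n))
  | Some m, None => point_mass (Some m)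
  | None, Some n => point_mass (Some n)
  | None, None => point_mass None
  end.

Definition Hhalf_haar : measureH :=
  mseries (fun n => mscale ((2^-1 : R) ^+ n.+1)%:nng (point_mass (Some n))) 0.

Definition Cintegrable (mu : measureH) (f : Hhalf -> C) : Prop :=
  mu.-integrable setT (fun x => (complex.Re (f x))%:E) /\
  mu.-integrable setT (fun x => (complex.Im (f x))%:E).

Definition Cintegral (mu : measureH) (f : Hhalf -> C) : C :=
  (\int[mu]_x complex.Re (f x)) +i* (\int[mu]_x complex.Im (f x)).

(* f(x * y), the integral of [f] against the convolution of point masses. *)
Definition conv_eval (f : Hhalf -> C) (x y : Hhalf) : C :=
  Cintegral (Hhalf_conv x y) f.

(* No involution on the argument of [g]: the involution of the hypergroup is
   the identity. *)
Definition fun_conv (f g : Hhalf -> C) (x : Hhalf) : C :=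
  Cintegral Hhalf_haar (fun y => conv_eval f x y * g y).

(* Local integrability is integrability, by compactness. Continuity is for the
   topology of [C] given by the modulus, and [0 <= z] in [C] says that [z] is
   real and nonnegative. *)
Definition positive_type (f : Hhalf -> C) : Prop :=
  Cintegrable Hhalf_haar f /\
  forall g : Hhalf -> C, continuous (g : Hhalf -> C^o) ->
    0 <= Cintegral Hhalf_haar
           (fun x => f x * fun_conv g (fun y => conjc (g y)) x).

Definition Hhalf_norm (p : \bar R) (f : Hhalf -> C) : \bar R :=
  Lnorm Hhalf_haar p (fun x => (Normc.normc (f x))%:E).

End Hypergroup.

(* Main.v *)
Require Import Defs.
From mathcomp Require Import all_boot all_order all_algebra.
From mathcomp Require Import complex.
From mathcomp Require Import all_classical all_reals all_analysis.
From mathcomp Require Import measurable_realfun ess_sup_inf hoelder.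
From mathcomp Require Import lra.
Import Order.TTheory GRing.Theory Num.Theory.
Import numFieldNormedType.Exports.
Local Open Scope complex_scope.
Local Open Scope classical_set_scope.
Local Open Scope ring_scope.

Set Implicit Arguments.
Unset Strict Implicit.
Unset Printing Implicit Defensive.

(** The neighbourhoods of infinity are the sets containing a tail
    [{n | N <= n}] together with infinity, and the functions
    [chi k = 2 * 1_(tail k) - 1_(tail k.-1)] are real continuous characters of
    the hypergroup ([chi_mul]), and the convolution square of [chi k] is a
    positive multiple of [chi k] ([chi_autoconv]).  Testing positivity of [f] on [g = chi k] thus
    says that the Fourier coefficients [int f * chi k] are nonnegative
    ([positive_type_chi]).

    Write [T k] for the integral of [f] over [tail k], and [D k = 2 ^ k * T k]
    for the mean of [f] over that tail.  Nonnegativity of the coefficients is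
    [0 <= 2 * T k - T k.-1], that is, [D] is nonnegative and nondecreasing.
    Since [tail k] is the disjoint union of [{k}] and [tail k.+1], and [k] has
    mass [2 ^ - k.+1], the function is recovered as
    [f k = 2 * D k - D k.+1].  Hence [|f k| <= D k.+1 <= D N] for every
    [k < N]: the finitely many values of [f] outside the tail are bounded by
    [2 ^ N] times its L^1 norm on the tail ([head_le_tail]).

    The Haar measure is a probability measure, so this bound controls the L^p
    norm of [f] off [U] by the L^1 norm of [f] on [U], and the latter by the
    L^p norm on [U], whatever [p] is; Minkowski's inequality concludes, with a
    constant that only depends on [N].  The argument is run separately on the
    real and imaginary parts of [f], which costs a factor 2. *)

(** * Tails, topology and Borel sets of the compactification *)

Definition tail (n : nat) : set Hhalf :=
  [set x : Hhalf | if x is Some m then (n <= m)%N else true].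

(** The complement of a neighbourhood of infinity is a compact set of integers,
    and a compact subset of a discrete space is finite. *)
Lemma nbhs_infty_tail (U : set Hhalf) :
  nbhs Hhalf_id U -> exists N, tail N `<=` U.
Proof.
case=> K [Kc _] KU; move/compact_near_coveringP: Kc => Kc.
(* Near-covering compactness applied to the filter of large bounds [N]. *)
have [N _ NK] : \forall N \near \oo, K `<=` (fun m => m < N)%N.
  apply: Kc => m _; exists ([set m], [set N | m < N]%N) => /=.
    by split; [exact: discrete_set1 | exists m.+1].
  by move=> [_ N] [/= -> mN].
exists N => -[m|] /= Nm; apply: KU; [left | by right].
by exists m => // Km; have := NK N (leqnn N) m Km; rewrite ltnNge Nm.
Qed.

(** Every integer is an isolated point, so only continuity at infinity is at
    stake, and there the function is locally constant. *)
Lemma continuous_of_tail (T : topologicalType) (g : Hhalf -> T) (N : nat) :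
  (forall n, (N <= n)%N -> g (Some n) = g None) -> continuous g.
Proof.
move=> gN [n|] A gA.
  change (nbhs n (fun m => A (g (Some m)))).
  by apply: (filterS _ (discrete_set1 n)) => m ->; exact: nbhs_singleton gA.
exists `I_N; first by split; [exact/finite_compact/finite_II | exact: discrete_closed].
move=> x [[m /negP mN <-]|->]; rewrite /preimage /=; last exact: nbhs_singleton gA.
have -> : g (Some m) = g None by apply: gN; rewrite leqNgt.
exact: nbhs_singleton gA.
Qed.

(** A set of integers is open, and a set that contains infinity is the
    complement of a set of integers. *)
Lemma Hhalf_measurable (A : set Hhalf) : measurable A.
Proof.
have ofnat (B : set nat) : measurable (Some @` B : set Hhalf).
  apply: sub_sigma_algebra; apply: one_point_compactification_open_some.
  exact: discrete_open.
have [AN|AN] := pselect (A None); last first.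
  rewrite (_ : A = Some @` (Some @^-1` A)) //.
  apply/seteqP; split => [[n|] An //|_ [n An <-] //]; by exists n.
rewrite (_ : A = ~` (Some @` (Some @^-1` (~` A)))); first exact: measurableC.
apply/seteqP; split => [x Ax [n nA nx]|[n|] //= nA]; first by apply: nA; rewrite nx.
by apply: contrapT => nAn; apply: nA; exists n.
Qed.

Lemma Hhalf_measurable_fun d (T : measurableType d) (f : Hhalf -> T) :
  measurable_fun [set: Hhalf] f.
Proof. by move=> _ Y _; exact: Hhalf_measurable. Qed.

(** * Masses of the tails *)

Section HalfSeries.
Context {R : realType}.

Lemma indic_tail (k : nat) (x : Hhalf) :
  \1_(tail k) x = (if x is Some n then (k <= n)%N else true)%:R :> R.
Proof.
by rewrite indicE; case: x => [n|]; congr (nat_of_bool _)%:R; apply/idP/idP; rewrite inE.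
Qed.

(** Covers the Haar measure, with [a = 0], and the convolution squares of the
    unit point masses, with [a = n.+1].  The truncated subtraction accounts for
    the tails that contain the whole support. *)
Lemma mass_tail (a i : nat) :
  mseries (fun l => mscale ((2^-1 : R) ^+ l.+1)%:nng
                            (point_mass (Some (a + l)%N))) 0 (tail i)
  = ((2^-1) ^+ (i - a))%:E.
Proof.
set w : nat -> \bar R := fun l => ((2^-1) ^+ l.+1 * (i - a <= l)%N%:R)%:E.
have w0 l : (0 <= w l)%E by rewrite lee_fin mulr_ge0 ?exprn_ge0 ?invr_ge0.
transitivity (\sum_(0 <= l <oo) w l)%E.
  apply: eq_eseriesr => l _.
  change (((2^-1) ^+ l.+1)%:E * (\1_(tail i) (Some (a + l)%N))%:E = w l)%E.
  by rewrite indic_tail -EFinM /w leq_subLR.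
rewrite (nneseries_split 0%N (i - a)%N) // add0n big1_seq ?add0e; last first.
  move=> l; rewrite mem_index_iota => /andP[_ /andP[_ ltl]].
  by rewrite /w leqNgt ltl mulr0.
rewrite -nneseries_addn //; apply/cvg_lim => //.
have := @cvg_geometric_eseries_half R 1 (i - a).
rewrite mul1r -exprVn; apply: cvg_trans; apply: near_eq_cvg.
near=> n; apply: eq_bigr => l _.
by rewrite /w leq_addl mulr1 mul1r natrX -exprVn addnS.
Unshelve. all: by end_near. Qed.

Lemma haar_tail (i : nat) :
  Hhalf_haar (R := R) (tail i) = ((2^-1) ^+ i)%:E.
Proof. by rewrite -[in RHS](subn0 i) -(mass_tail 0). Qed.

Lemma diag_conv_tail (m i : nat) :
  diag_conv (R := R) m (tail i) = ((2^-1) ^+ (i - m.+1))%:E.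
Proof.
rewrite -(mass_tail m.+1); apply: eq_eseriesr => l _.
by rewrite /mscale /= addSnnS.
Qed.
End HalfSeries.

(** * Characters *)

Section Characters.
Context {R : realType}.
Local Notation haar := (Hhalf_haar (R := R)).
Implicit Types (mu : {measure set Hhalf -> \bar R}) (h : Hhalf -> R).

(** For [0 < k], [chi k] vanishes below [k.-1], takes the value -1 at [k.-1] and
    1 from [k] on; [chi 0] is the constant 1, as [0.-1 = 0].  Writing it with
    tails makes its integrals immediate, for any measure. *)
Definition chi (k : nat) (x : Hhalf) : R := 2 * \1_(tail k) x - \1_(tail k.-1) x.

Lemma chiE (k : nat) (x : Hhalf) :
  chi k x = if x is Some n then (k <= n)%N%:R - (k == n.+1)%N%:R else 1.
Proof.
rewrite /chi !indic_tail; case: x => [n|]; last by rewrite /=; lra.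
case: k => [|k]; first by rewrite !leq0n /= mulr1 subr0 -[2]/(1 + 1) addrK.
rewrite eqSS [k.+1.-1]/=; case: ltngtP => _ /=; lra.
Qed.

Lemma Rintegral_tail mu h (N : nat) :
  \int[mu]_(x in tail N) h x = \int[mu]_x (h x * \1_(tail N) x).
Proof. by rewrite Rintegral_mkcond patch_indic. Qed.

Lemma integrable_tail mu h (N : nat) : mu.-integrable setT (EFin \o h) ->
  mu.-integrable setT (EFin \o (fun x => h x * \1_(tail N) x)).
Proof.
move=> hi; apply: (le_integrable measurableT _ _ hi).
  exact: Hhalf_measurable_fun.
move=> x _; rewrite /= lee_fin normrM indicE; case: (_ \in _).
  by rewrite normr1 mulr1.
by rewrite normr0 mulr0.
Qed.

Lemma integral_chi mu h (k : nat) : mu.-integrable setT (EFin \o h) ->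
  \int[mu]_x (h x * chi k x) =
  2 * \int[mu]_(x in tail k) h x - \int[mu]_(x in tail k.-1) h x.
Proof.
move=> hi; rewrite !Rintegral_tail.
have i1 := integrable_tail k hi; have i2 := integrable_tail k.-1 hi.
have i3 : mu.-integrable setT (EFin \o (fun x => 2 * (h x * \1_(tail k) x))).
  exact: integrableZl i1.
rewrite -RintegralZl // -RintegralB //.
by apply: eq_Rintegral => x _; rewrite /chi mulrBr mulrCA.
Qed.

Lemma integrable_cst1 mu : (mu setT < +oo)%E -> mu.-integrable setT (EFin \o cst (1 : R)).
Proof.
move=> mufin; apply: measurable_bounded_integrable => //.
exact: bounded_cst.
Qed.

Lemma setT_tail0 : setT = tail 0.
Proof. by apply/seteqP; split => // -[]. Qed.

Lemma haar_setT : haar setT = 1%E.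
Proof. by rewrite setT_tail0 haar_tail expr0. Qed.

Lemma mean_chi mu (k : nat) : (mu setT < +oo)%E ->
  \int[mu]_x chi k x = 2 * fine (mu (tail k)) - fine (mu (tail k.-1)).
Proof.
move=> /integrable_cst1 i1.
transitivity (\int[mu]_x (1 * chi k x)).
  by apply: eq_Rintegral => x _; rewrite mul1r.
rewrite (integral_chi k i1) !Rintegral_cst ?mul1r //; exact: Hhalf_measurable.
Qed.

Lemma Rintegral_point_mass (a : Hhalf) h : \int[point_mass a]_x h x = h a.
Proof.
rewrite /Rintegral /point_mass integral_dirac //; last exact: Hhalf_measurable_fun.
by rewrite diracT mul1e.
Qed.

(** Only the diagonal [x = y = m] uses the shape of the convolution, which is
    spread over [tail m.+1] with masses 1/2, 1/4, and so on.  If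
    [k <= m.+1], then [chi k] is 1 there.  Otherwise the point [k.-1], where
    [chi k = -1], has the same mass as [tail k], and the integral vanishes, as
    [chi k m] does.  Off the diagonal, [chi k] is 1 at the larger integer unless
    it vanishes at the smaller one. *)
Lemma chi_mul (k : nat) (x y : Hhalf) :
  \int[Hhalf_conv x y]_z chi k z = chi k x * chi k y.
Proof.
case: x y => [m|] [n|]; last first.
- by rewrite Rintegral_point_mass !chiE mul1r.
- by rewrite Rintegral_point_mass !chiE mul1r.
- by rewrite Rintegral_point_mass !chiE mulr1.
rewrite [Hhalf_conv _ _]/=; case: eqVneq => [<-|mn].
  rewrite mean_chi ?setT_tail0 !diag_conv_tail ?ltry //=.
  rewrite !chiE; have [km|mk] := leqP k m.+1.
    have /eqP -> : (k - m.+1 == 0)%N by rewrite subn_eq0.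
    have /eqP -> : (k.-1 - m.+1 == 0)%N by rewrite subn_eq0 (leq_trans (leq_pred k)).
    move: km; rewrite leq_eqVlt ltnS => /predU1P[->|km].
      by rewrite ltnn eqxx expr0 /=; lra.
    by rewrite km ltn_eqF // expr0 /=; lra.
  have -> : (k - m.+1)%N = (k.-1 - m.+1).+1 by case: k mk => // k mk; rewrite subSn.
  rewrite exprS mulrA divff ?pnatr_eq0 // mul1r subrr.
  by rewrite leqNgt (ltn_trans _ mk) // gtn_eqF // subrr mulr0.
rewrite Rintegral_point_mass.
wlog lt_mn : m n {mn} / (m < n)%N => [hw|].
  move: mn; rewrite neq_ltn => /orP[|] lt_mn; first exact: hw.
  by rewrite minnC mulrC hw.
rewrite (minn_idPl (ltnW lt_mn)) !chiE; have [km|mk] := leqP k m.+1.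
  have kn : (k <= n)%N by exact: leq_trans km _.
  by rewrite kn (@ltn_eqF k n.+1) ?ltnS //= subr0 mulr1.
by rewrite leqNgt (ltn_trans _ mk) // gtn_eqF // subrr mul0r.
Qed.
End Characters.

(** * Functions of positive type *)

Section PositiveType.
Context {R : realType}.
Local Notation haar := (Hhalf_haar (R := R)).
Implicit Types (f : Hhalf -> R[i]) (h : Hhalf -> R).

Lemma Cintegral_real (mu : {measure set Hhalf -> \bar R}) h :
  Cintegral mu (fun x => (h x)%:C) = (\int[mu]_x h x)%:C.
Proof. by rewrite /Cintegral /= Rintegral_cst // mul0r. Qed.

Lemma continuous_chi (k : nat) :
  continuous ((fun x => (chi k x)%:C) : Hhalf -> R[i]^o).
Proof.
apply: (@continuous_of_tail _ _ k) => n kn.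
by rewrite !chiE kn ltn_eqF ?ltnS // subr0.
Qed.

Lemma chi_sqr (k : nat) (x : Hhalf) : chi k x * chi k x = \1_(tail k.-1) x :> R.
Proof.
rewrite indic_tail chiE; case: x => [n|]; last by rewrite mulr1.
case: k => [|k]; first by rewrite /= subr0 mulr1.
rewrite eqSS [k.+1.-1]/=; case: ltngtP => _ /=; lra.
Qed.

(** By multiplicativity, the convolution of [chi k] with itself at [x] is
    [chi k x] times the squared L^2 norm of [chi k]. *)
Lemma chi_autoconv (k : nat) : exists2 a : R, 0 < a & forall x,
  fun_conv (fun y => (chi k y)%:C) (fun y => conjc (chi k y)%:C) x =
  (a * chi k x)%:C.
Proof.
exists ((2^-1) ^+ k.-1); first by rewrite exprn_gt0 ?invr_gt0.
move=> x; rewrite /fun_conv.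
transitivity (Cintegral haar (fun y => (chi k x * \1_(tail k.-1) y)%:C)).
  congr Cintegral; apply/funext => y.
  rewrite /conv_eval Cintegral_real chi_mul conjc_real -rmorphM /= -chi_sqr.
  by rewrite mulrA.
rewrite Cintegral_real; congr (_%:C).
rewrite (@eq_Rintegral _ _ _ _ _ (fun y => chi k x * \1_(tail k.-1) y)) //.
rewrite mulrC -Rintegral_tail Rintegral_cst ?haar_tail //.
exact: Hhalf_measurable.
Qed.

(** A complex number is nonnegative when its imaginary part is zero and its real
    part nonnegative, so the inequality for [Im f] is in fact an equality; the
    weaker form lets both parts be treated alike. *)
Lemma positive_type_chi f (k : nat) : positive_type f ->
  0 <= \int[haar]_x (complex.Re (f x) * chi k x) /\
  0 <= \int[haar]_x (complex.Im (f x) * chi k x).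
Proof.
move=> [[iRe iIm] fpos]; have [a a0 convE] := chi_autoconv k.
have := fpos _ (@continuous_chi k).
set J := Cintegral _ _; have -> : J =
    (a * \int[haar]_x (complex.Re (f x) * chi k x)) +i*
    (a * \int[haar]_x (complex.Im (f x) * chi k x)).
  have bnd h : haar.-integrable setT (EFin \o h) ->
      haar.-integrable setT (EFin \o (fun x => h x * chi k x)).
    move=> hi; rewrite (_ : EFin \o _ =
      EFin \o (fun x => 2 * (h x * \1_(tail k) x) - h x * \1_(tail k.-1) x)).
      have i1 := integrableZl measurableT 2 (integrable_tail k hi).
      exact: integrableB i1 (integrable_tail k.-1 hi).
    by apply/funext => x /=; rewrite /chi mulrBr mulrCA.
  rewrite /J /Cintegral -!RintegralZl //; [ | exact: bnd | exact: bnd].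
  congr (_ +i* _); apply: eq_Rintegral => x _;
    rewrite convE; case: (f x) => u v /=; lra.
rewrite lecE /= => /andP[/eqP Im0 Re0]; split.
  by rewrite -(pmulr_rge0 _ a0).
by rewrite -(pmulr_rge0 _ a0) Im0.
Qed.

(** With [D k = 2 ^ k * T k], the mean of [h] over [tail k], the hypothesis says
    that [D] is nonnegative and nondecreasing, while [h k = 2 * D k - D k.+1];
    hence [- D k.+1 <= h k <= D k.+1]. *)
Lemma head_le_tail h (N n : nat) : haar.-integrable setT (EFin \o h) ->
  (forall k, 0 <= \int[haar]_x (h x * chi k x)) ->
  (n < N)%N -> `|h (Some n)| <= 2 ^+ N * \int[haar]_(x in tail N) `|h x|.
Proof.
move=> hi hchi nN.
pose T k := \int[haar]_(x in tail k) h x.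
pose D k := 2 ^+ k * T k.
have TS k : T k = (2^-1) ^+ k.+1 * h (Some k) + T k.+1.
  have tailE : tail k = [set Some k] `|` tail k.+1.
    apply/seteqP; split => [[m|] xk|y [->|]].
    - by move: xk => /=; rewrite leq_eqVlt => /predU1P[->|?]; [left|right].
    - by right.
    - exact: leqnn.
    - by case: y => // m; exact: ltnW.
  have dis : [disjoint [set Some k : Hhalf] & tail k.+1].
    by apply/disj_setPS => y [-> /=]; rewrite ltnn.
  have mass1 : (haar [set Some k : Hhalf] = ((2^-1) ^+ k.+1)%:E)%E.
    have : (haar (tail k) = haar [set Some k : Hhalf] + haar (tail k.+1))%E.
      rewrite tailE measureU //; try exact: Hhalf_measurable.
      exact/disj_set2P.
    rewrite !haar_tail; case: (haar [set Some k : Hhalf]) => // r [].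
    by rewrite exprS => massE; congr (_%:E); lra.
  rewrite /T tailE Rintegral_setU //; try exact: Hhalf_measurable; last first.
    by apply: integrableS hi => //; exact: Hhalf_measurable.
  congr (_ + _).
  rewrite (@eq_Rintegral _ _ _ _ _ (cst (h (Some k)))); last first.
    by move=> x; rewrite inE /= => ->.
  by rewrite Rintegral_cst; [rewrite mass1 mulrC | exact: Hhalf_measurable].
have DS k : h (Some k) = 2 * D k - D k.+1.
  rewrite /D exprS -mulrA -!mulrBr (TS k) addrK !mulrA -exprS.
  by rewrite -exprMn divff ?pnatr_eq0 // expr1n mul1r.
have hD k : 0 <= 2 * T k - T k.-1 by rewrite -integral_chi.
have D0 : 0 <= D 0%N by have := hD 0%N; rewrite /D expr0 /=; lra.
have Dincr k : D k <= D k.+1.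
  have := hD k.+1; rewrite /D /= exprS => /(mulr_ge0 (exprn_ge0 k (ler0n R 2))).
  by lra.
have Dge0 k : 0 <= D k by elim: k => // k /le_trans; apply.
have Dmono : {homo D : i j / (i <= j)%N >-> i <= j} by apply/nondecreasing_seqP.
apply: (@le_trans _ _ (D N)); last first.
  rewrite ler_wpM2l ?exprn_ge0 //; apply: le_trans (ler_norm _) _.
  apply: le_normr_Rintegral; first exact: Hhalf_measurable.
  by apply: integrableS hi => //; exact: Hhalf_measurable.
apply: (@le_trans _ _ (D n.+1)); last exact: Dmono.
rewrite DS ler_norml; have := Dge0 n; have := Dincr n; lra.
Qed.
End PositiveType.

(** * L^p norms for a probability measure *)

Section ProbabilityNorms.
Context d (T : measurableType d) (R : realType).
Implicit Types (mu : {measure set T -> \bar R}) (g : T -> R) (p : \bar R).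

Lemma Lnorm_le_bound mu p g (M : R) :
  mu setT = 1%E -> (1 <= p)%E -> measurable_fun setT g ->
  (forall x, `|g x| <= M) -> (Lnorm mu p (EFin \o g) <= M%:E)%E.
Proof.
move=> mu1 p1 mg gM.
have M0 : 0 <= M by exact: le_trans (gM point).
rewrite unlock; case: p p1 => [r r1|_|//]; last first.
  rewrite mu1 lte01; apply/ess_supP/nearW => x; rewrite /= lee_fin; exact: gM.
have r0 : 0 < r by move: r1; rewrite lee_fin; exact: lt_le_trans.
have -> : M%:E = ((\int[mu]_x (M `^ r)%:E) `^ r^-1)%E.
  by rewrite integral_cst // mu1 mule1 poweR_EFin -powRrM mulfV ?gt_eqF // powRr1.
apply: gt0_ler_poweR.
- by rewrite invr_ge0 ltW.
- by rewrite in_itv /= leey andbT; apply: integral_ge0 => x _; rewrite lee_fin powR_ge0.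
- by rewrite in_itv /= leey andbT; apply: integral_ge0 => x _; rewrite lee_fin powR_ge0.
apply: ge0_le_integral => //.
- by move=> x _; exact: poweR_ge0.
- apply: (measurableT_comp (measurable_poweR _)) => //.
  by apply: measurableT_comp => //; exact/measurable_EFinP.
- by move=> x _; rewrite /= lee_fin ge0_ler_powR // ?nnegrE ?ltW.
Qed.

(** Hoelder's inequality against the constant 1 when [1 < p] is finite. *)
Lemma Lnorm1_le mu p g : mu setT = 1%E -> (1 <= p)%E -> measurable_fun setT g ->
  (Lnorm mu 1 (EFin \o g) <= Lnorm mu p (EFin \o g))%E.
Proof.
move=> mu1; case: p => [r r1 mg|_ mg|//].
  move: r1; rewrite lee_fin le_eqVlt => /predU1P[<- //|r1].
  have r0 : 0 < r by rewrite (lt_trans _ r1).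
  pose q := (1 - r^-1)^-1.
  have q0 : 0 < q by rewrite invr_gt0 subr_gt0 invf_lt1.
  have rq : r^-1 + q^-1 = 1 by rewrite /q invrK addrC subrK.
  have := @hoelder _ _ _ mu g (cst 1) r q mg (measurable_cst _) r0 q0 rq.
  have -> : (g \* cst 1)%R = g by apply/funext => x /=; rewrite mulr1.
  by rewrite [X in (_ * X)%E]Lnorm_cst1 mu1 poweR1r mule1.
rewrite Lnorm1 unlock mu1 lte01.
set E := ess_sup _ _.
have -> : E = (\int[mu]_x E)%E by rewrite integral_cst // mu1 mule1.
apply: ae_ge0_le_integral => //.
- by apply: measurableT_comp => //; exact/measurable_EFinP.
- by move=> x _; apply: ess_sup_gee; [rewrite mu1 lte01 | apply: nearW => y; exact: abse_ge0].
- by apply: filterS (ess_sup_ge mu (abse \o (EFin \o g))) => x + _.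
Qed.

End ProbabilityNorms.

(** * Comparison of norms *)

Section Normc.
Context {R : realType}.
Implicit Types z : R[i].

Lemma ler_Re_normc z : `|complex.Re z| <= Normc.normc z.
Proof. by case: z => a b /=; rewrite -sqrtr_sqr ler_wsqrtr // lerDl sqr_ge0. Qed.

Lemma ler_Im_normc z : `|complex.Im z| <= Normc.normc z.
Proof. by case: z => a b /=; rewrite -sqrtr_sqr ler_wsqrtr // lerDr sqr_ge0. Qed.

Lemma normc_ge0 z : 0 <= Normc.normc z.
Proof. exact: le_trans (normr_ge0 _) (ler_Re_normc z). Qed.

Lemma normc_le_ReIm z : Normc.normc z <= `|complex.Re z| + `|complex.Im z|.
Proof.
case: z => a b /=; rewrite -[leRHS]ger0_norm ?addr_ge0 // -sqrtr_sqr ler_wsqrtr //.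
rewrite sqrrD !real_normK ?num_real // addrAC lerDl mulrn_wge0 // mulr_ge0 //.
Qed.

Lemma normc_real_mul z (a : R) : 0 <= a -> Normc.normc (z * a%:C) = Normc.normc z * a.
Proof.
by move=> a0; rewrite Normc.normcM /= expr0n addr0 sqrtr_sqr ger0_norm.
Qed.

End Normc.

Section Main.
Context {R : realType}.
Local Notation haar := (Hhalf_haar (R := R)).
Implicit Types f : Hhalf -> R[i].

Lemma integrable_normc f : Cintegrable haar f ->
  haar.-integrable setT (EFin \o (fun x => Normc.normc (f x))).
Proof.
move=> [iRe iIm].
apply: (le_integrable measurableT _ _
  (integrableD measurableT (integrable_abse iRe) (integrable_abse iIm))) => //=.
  exact: Hhalf_measurable_fun.
move=> x _; rewrite lee_fin ger0_norm ?normc_ge0 // [leRHS]ger0_norm ?addr_ge0 //.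
exact: normc_le_ReIm.
Qed.

(** The exponent [N.+1] absorbs the factor 2 lost by adding the bounds for the
    real and imaginary parts. *)
Lemma positive_type_head f (N n : nat) : positive_type f -> (n < N)%N ->
  Normc.normc (f (Some n)) <=
    2 ^+ N.+1 * \int[haar]_(x in tail N) Normc.normc (f x).
Proof.
move=> fpos nN; have [[iRe iIm] _] := fpos.
have le_normc (h : Hhalf -> R) : haar.-integrable setT (EFin \o h) ->
    (forall x, `|h x| <= Normc.normc (f x)) ->
    \int[haar]_(x in tail N) `|h x| <= \int[haar]_(x in tail N) Normc.normc (f x).
  move=> hi hf; apply: le_Rintegral => //; first exact: Hhalf_measurable.
  - apply: integrableS (integrable_abse hi) => //; exact: Hhalf_measurable.
  - by apply: integrableS (integrable_normc (conj iRe iIm)) => //; exact: Hhalf_measurable.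
apply: le_trans (normc_le_ReIm _) _.
have hRe := head_le_tail iRe (fun k => (positive_type_chi k fpos).1) nN.
have hIm := head_le_tail iIm (fun k => (positive_type_chi k fpos).2) nN.
rewrite exprS -mulrA mulr_natl mulr2n.
apply: lerD; [apply: le_trans hRe _|apply: le_trans hIm _];
  rewrite ler_wpM2l ?exprn_ge0 //; apply: le_normc => // x.
- exact: ler_Re_normc.
- exact: ler_Im_normc.
Qed.

End Main.

Theorem corollary34 (R : realType) (U : set Hhalf) (hU : nbhs Hhalf_id U) :
  exists C_U : R, forall (p : \bar R) (f : Hhalf -> R[i]),
    (1 <= p)%E -> positive_type f ->
    (Hhalf_norm p f <= C_U%:E * Hhalf_norm p (fun x => (f x * (\1_U x)%:C)%R))%E.
Proof.
have [N NU] := nbhs_infty_tail hU.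
exists (1 + 2 ^+ N.+1) => p f p1 fpos.
pose haar := Hhalf_haar (R := R).
pose phi x : R := Normc.normc (f x).
pose phiU x : R := phi x * \1_U x.
pose phiC x : R := phi x * \1_(~` U) x.
have phi0 x : 0 <= phi x by exact: normc_ge0.
have phiU0 x : 0 <= phiU x by rewrite mulr_ge0 // indicE; case: (x \in U).
have iphi : haar.-integrable setT (EFin \o phi) by apply: integrable_normc; case: fpos.
have iphiU : haar.-integrable setT (EFin \o phiU).
  apply: (le_integrable measurableT _ _ iphi); first exact: Hhalf_measurable_fun.
  move=> x _; rewrite lee_fin /phiU normrM indicE ler_piMr //.
  by case: (x \in U); rewrite ?normr1 ?normr0.
have normU : Hhalf_norm p (fun x => f x * (\1_U x)%:C) = Lnorm haar p (EFin \o phiU).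
  by apply: eq_Lnorm => x /=; rewrite normc_real_mul.
have meas (g : Hhalf -> R) : measurable_fun setT g by exact: Hhalf_measurable_fun.
have Lnorm1U : Lnorm haar 1 (EFin \o phiU) = (\int[haar]_x phiU x)%:E.
  rewrite Lnorm1 /Rintegral fineK; last exact: integrable_fin_num.
  by apply: eq_integral => x _; rewrite /= ger0_norm.
have tail_le : \int[haar]_(x in tail N) phi x <= \int[haar]_x phiU x.
  rewrite Rintegral_tail; apply: le_Rintegral => //.
    exact: integrable_tail.
  move=> x _; rewrite ler_wpM2l // !indicE.
  by case: (boolP (x \in tail N)) => // /set_mem/NU/mem_set ->.
(* A point outside [U] is an integer below [N], as [U] contains [tail N]. *)
have phiC_le x : `|phiC x| <= 2 ^+ N.+1 * \int[haar]_y phiU y.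
  have rhs0 : 0 <= 2 ^+ N.+1 * \int[haar]_y phiU y.
    by rewrite mulr_ge0 ?exprn_ge0 // Rintegral_ge0.
  rewrite /phiC indicE; case: (boolP (x \in ~` U)) => [/set_mem nUx|_]; last first.
    by rewrite mulr0 normr0.
  rewrite mulr1 ger0_norm //; case: x nUx => [n|] nUx; last by case: nUx; apply: NU.
  have nN : (n < N)%N by rewrite ltnNge; apply/negP => Nn; apply: nUx; apply: NU.
  apply: le_trans (positive_type_head fpos nN) _.
  by rewrite ler_wpM2l ?exprn_ge0.
have phiE : phi = (phiU \+ phiC)%R.
  apply/funext => x; rewrite /= -mulrDr !indicE in_setC.
  by case: (x \in U); rewrite ?addr0 ?add0r mulr1.
rewrite normU -[Hhalf_norm p f]/(Lnorm haar p (EFin \o phi)) phiE.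
apply: le_trans (eminkowski _ (meas _) (meas _) p1) _.
rewrite EFinD ge0_muleDl ?lee_fin ?exprn_ge0 // mul1e.
apply: leeD => //.
apply: le_trans (Lnorm_le_bound (haar_setT) p1 (meas _) phiC_le) _.
rewrite EFinM -Lnorm1U; apply: lee_wpmul2l; first by rewrite lee_fin exprn_ge0.
exact: (Lnorm1_le haar_setT p1 (meas _)).
Qed.
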